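(* If $G$ is a twin-free cubic graph of (finite) order $n \ge 46$, then $\textrm{ERR:LD}(G) \le \left\lceil \frac{45}{46} n \right\rceil$.
   Context: Graphs are simple and undirected. A graph is cubic if it is 3-regular; its order is its number of vertices. $N(v)$ is the open neighborhood of $v$ and $N[v]=N(v)\cup\{v\}$. Two distinct vertices $u,v$ are twins if $N[u]=N[v]$ or $N(u)=N(v)$; a graph is twin-free if it has no twins. ERR:LD sets (error-correcting locating-dominating sets): $S \subseteq V(G)$ is a set of detectors. At most one intruder is present, located at some vertex. A correctly working detector $v\in S$ transmits $2$ if the intruder is at $v$, $1$ if the intruder is in $N(v)$, and $0$ otherwise. At most one detector may transmit an incorrect value. $S$ is an ERR:LD set if, from the transmitted values, one can always determine whether an intruder is present and, if so, its exact location. Equivalently: $|N[v] \cap S| \ge 3$ for all $v\in V(G)$, and $|((N(v) \cap S) \triangle (N(u) \cap S)) - \{v,u\}| \ge 3 - |\{v,u\}\cap S|$ for all distinct $u,v\in V(G)$. $\textrm{ERR:LD}(G)$ is the minimum cardinality of an ERR:LD set for $G$. *)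

(* Defs.v *)
From mathcomp Require Import all_boot all_order all_algebra.

Set Implicit Arguments.
Unset Strict Implicit.
Unset Printing Implicit Defensive.

(* A simple graph is a symmetric irreflexive relation [e] on a finite type. *)
Definition open_nbhd (V : finType) (e : rel V) (v : V) : {set V} :=
  [set u | e v u].

Definition closed_nbhd (V : finType) (e : rel V) (v : V) : {set V} :=
  v |: open_nbhd e v.

Definition cubic (V : finType) (e : rel V) : Prop :=
  forall v : V, #|open_nbhd e v| = 3.

Definition twins (V : finType) (e : rel V) (u v : V) : bool :=
  (u != v) && ((closed_nbhd e u == closed_nbhd e v)
               || (open_nbhd e u == open_nbhd e v)).

Definition twin_free (V : finType) (e : rel V) : Prop :=
  forall u v : V, ~~ twins e u v.

(* The state of the system is [None] when there is no intruder, and [Some x]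
   when the intruder is at [x].  [signal e v s] is the value that a correctly
   working detector at [v] transmits in state [s]. *)
Definition signal (V : finType) (e : rel V) (v : V) (s : option V) : 'I_3 :=
  match s with
  | None => @Ordinal 3 0 isT
  | Some x => if x == v then @Ordinal 3 2 isT
              else if x \in open_nbhd e v then @Ordinal 3 1 isT
              else @Ordinal 3 0 isT
  end.

(* One transmitted value for each detector in [S]. *)
Definition transmission (V : finType) (S : {set V}) :=
  {ffun {v : V | v \in S} -> 'I_3}.

Definition possible (V : finType) (e : rel V) (S : {set V})
    (s : option V) (r : transmission S) : bool :=
  #|[set w | r w != signal e (val w) s]| <= 1.

(* Some decoder recovers the state from every transmission in which at most
   one detector is wrong. *)
Definition errld_set (V : finType) (e : rel V) (S : {set V}) : bool :=
  [exists decode : {ffun transmission S -> option V},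
     forall s : option V, forall r : transmission S,
       possible e s r ==> (decode r == s)].

(* If there is no error-correcting locating-dominating set at all, the value
   is the junk value #|V|; see [ERRLD_spec]. *)
Definition ERRLD (V : finType) (e : rel V) : nat :=
  #|[arg min_(S < [set: V] | errld_set e S) #|S|]|.

Lemma errld_set_dist (V : finType) (e : rel V) (S : {set V}) :
  errld_set e S <->
  (forall s t : option V, s != t ->
     2 < #|[set w in S | signal e w s != signal e w t]|).
Proof.
have cardE s t : #|[set w in S | signal e w s != signal e w t]| =
    #|[set w : {v | v \in S} | signal e (val w) s != signal e (val w) t]|.
  rewrite -(card_imset _ val_inj); apply: eq_card => w; rewrite inE.
  apply/idP/imsetP => [/andP[wS ne]|[[x xS] /=]].
    by exists (exist _ w wS); rewrite ?inE.
  by rewrite inE /= => ne ->; rewrite xS.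
split=> [/existsP[dec /forallP decP] s t nst|far].
  rewrite cardE ltnNge; apply/negP => le2; set D := [set w | _] in le2.
  suff [r rs rt] : exists2 r : transmission S, possible e s r & possible e t r.
    have /forallP/(_ r)/implyP/(_ rs)/eqP ds := decP s.
    have /forallP/(_ r)/implyP/(_ rt)/eqP dt := decP t.
    by move: nst; rewrite -ds -dt eqxx.
  have [D0|[d dD]] := set_0Vmem D.
    have DF w : (w \in D) = false by rewrite D0 inE.
    exists [ffun w => signal e (val w) s]; rewrite /possible.
      by rewrite (_ : [set w | _] = set0) ?cards0 //;
        apply/setP=> w; rewrite !inE ffunE eqxx.
    by rewrite (_ : [set w | _] = set0) ?cards0 //;
      apply/setP=> w; have := DF w; rewrite !inE ffunE.
  exists [ffun w => signal e (val w) (if w == d then s else t)].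
    apply: (@leq_trans #|D :\ d|); last first.
      by rewrite -ltnS (leq_trans _ le2) // (cardsD1 d D) dD.
    apply: subset_leq_card; apply/subsetP => w; rewrite !inE ffunE.
    by case: (w == d); rewrite ?eqxx // eq_sym.
  apply: (@leq_trans #|[set d]|); last by rewrite cards1.
  apply: subset_leq_card; apply/subsetP => w; rewrite !inE ffunE.
  by case: (w == d); rewrite ?eqxx.
apply/existsP.
exists [ffun r : transmission S => odflt None [pick s | possible e s r]].
apply/forallP => s; apply/forallP => r; apply/implyP => rs; rewrite ffunE.
case: pickP => [t rt|/(_ s)]; last by rewrite rs.
rewrite /=; apply/negPn/negP => nts; have := far _ _ nts.
rewrite cardE ltnNge => /negP; apply.
apply: leq_trans (leq_add rt rs).
apply: leq_trans (leq_card_setU _ _).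
apply: subset_leq_card; apply/subsetP => w; rewrite !inE.
by apply: contraR; rewrite negb_or !negbK => /andP[/eqP <- /eqP <-].
Qed.

Lemma errld_setP (V : finType) (e : rel V) (S : {set V}) :
  symmetric e ->
  let N v := open_nbhd e v :&: S in
  errld_set e S <->
  (forall v, 3 <= #|closed_nbhd e v :&: S|) /\
  (forall u v, u != v ->
     3 - #|[set v; u] :&: S|
       <= #|((N v :\: N u) :|: (N u :\: N v)) :\: [set v; u]|).
Proof.
move=> sym N.
have card1 v : #|[set w in S | signal e w None != signal e w (Some v)]| =
    #|closed_nbhd e v :&: S|.
  apply: eq_card => w; rewrite !inE sym andbC (eq_sym w v) /=; congr (_ && _).
  by case: (v == w) => //=; rewrite inE sym; case: (e _ _).
have card2 u v : u != v ->
    #|[set w in S | signal e w (Some u) != signal e w (Some v)]| =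
    #|[set v; u] :&: S| +
    #|((N v :\: N u) :|: (N u :\: N v)) :\: [set v; u]|.
  move=> nuv; rewrite -(cardsID [set v; u]); congr (_ + _); apply: eq_card => w.
    rewrite !inE /= [RHS]andbC; case: (w \in S) => //=.
    have [->|nwv] := eqVneq w v.
      by rewrite (negPf nuv) andbT; case: ifP.
    have [->|nwu] := eqVneq w u; last by rewrite andbF.
    by rewrite andbT; case: ifP.
  rewrite !inE /=; have [//|nwv] := eqVneq w v.
  have [//|nwu] := eqVneq w u; rewrite /= !inE (sym u) (sym v).
  by case: (w \in S); case: (e w u); case: (e w v).
apply: iff_trans (errld_set_dist e S) _; split=> [far|[far1 far2] [u|] [v|] //].
- split=> [v|u v nuv]; first by rewrite -card1; apply: far.
  by rewrite leq_subLR -card2 //; apply: far.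
- by move=> nuv; rewrite card2 // -leq_subLR; apply: far2.
- move=> _; rewrite (leq_trans (far1 u)) // -card1 subset_leq_card //.
  by apply/subsetP => w; rewrite !inE eq_sym.
- by move=> _; rewrite card1.
Qed.

Lemma ERRLD_spec (V : finType) (e : rel V) (S0 : {set V}) :
  errld_set e S0 ->
  (exists2 S, errld_set e S & ERRLD e = #|S|) /\
  (forall S, errld_set e S -> ERRLD e <= #|S|).
Proof.
move=> /errld_set_dist far; rewrite /ERRLD.
have eT : errld_set e [set: V].
  apply/errld_set_dist => s t /far /leq_trans; apply; apply: subset_leq_card.
  by apply/subsetP => w; rewrite !inE => /andP[].
by case: arg_minnP => // S eS minS; split; [exists S | exact: minS].
Qed.

(* Main.v *)
(** Balls of radius 4 in a cubic graph have at most 1 + 3 + 6 + 12 + 24 = 46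
    vertices, so a maximal set [X] of vertices pairwise at distance at least 5
    has at least n/46 elements.  The complement of [X] is an ERR:LD set: in a
    twin-free cubic graph the differences N(u) - N[v] and N(v) - N[u] have the
    same size d >= 1; [X] meets each closed neighborhood at most once, which
    suffices if d >= 2; and if d = 1, then [u] and [v] are adjacent or have a
    common neighbor, so that all the vertices involved are within distance 4
    of each other and at most one of them is in [X]. *)
Require Import Defs.
From mathcomp Require Import all_boot all_order all_algebra.
From mathcomp Require Import zify lra.

Set Implicit Arguments.
Unset Strict Implicit.
Unset Printing Implicit Defensive.

Lemma leq_card_bigcup (I T : finType) (A : {set I}) (F : I -> {set T})
    (c : nat) :
  (forall i, i \in A -> #|F i| <= c) -> #|\bigcup_(i in A) F i| <= #|A| * c.
Proof.
move=> Fc; rewrite -sum_nat_const.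
apply: (big_ind2 (fun (B : {set T}) m => #|B| <= m)) => // [|B m C k Bm Ck].
  by rewrite cards0.
by rewrite (leq_trans (leq_card_setU _ _)) ?leq_add.
Qed.

Lemma closed_nbhdE (V : finType) (e : rel V) (u v : V) :
  (u \in closed_nbhd e v) = (u == v) || e v u.
Proof. by rewrite !inE. Qed.

(** * Sizes of balls in cubic graphs, and large packings *)

Section Balls.
Variables (V : finType) (e : rel V).
Hypotheses (e_sym : symmetric e) (e_cubic : cubic e).

(* The ends of the non-backtracking walks with at most [k] steps that start at
   [v] just after the step from [u] to [v]. *)
Fixpoint branch (k : nat) (u v : V) : {set V} :=
  if k is k'.+1 then v |: \bigcup_(w in open_nbhd e v :\ u) branch k' v w
  else [set v].

(** The vertices at distance at most [k] from [v], provided [k > 0]; [ball 0] coincides with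
    [ball 1]. *)
Definition ball (k : nat) (v : V) : {set V} :=
  v |: \bigcup_(w in open_nbhd e v) branch k.-1 v w.

(** Excluding [u] leaves two continuations from [v], so the walks form a binary tree with 1 + 2 +
    ... + 2^k nodes. *)
Lemma card_branch k u v : e u v -> #|branch k u v| <= 2 ^ k.+1 - 1.
Proof.
elim: k u v => [|k IHk] u v uv; first by rewrite cards1.
rewrite /= (leq_trans (leq_card_setU _ _)) // cards1.
have cN : #|open_nbhd e v :\ u| = 2.
  by have := cardsD1 u (open_nbhd e v); rewrite e_cubic inE e_sym uv; lia.
have: #|\bigcup_(w in open_nbhd e v :\ u) branch k v w| <= 2 * (2 ^ k.+1 - 1).
  rewrite -{1}cN; apply: leq_card_bigcup => w; rewrite !inE => /andP[_].
  exact: IHk.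
by rewrite [2 ^ k.+2]expnS; have := expn_gt0 2 k.+1; lia.
Qed.

Lemma card_ball4 v : #|ball 4 v| <= 46.
Proof.
have: #|\bigcup_(w in open_nbhd e v) branch 3 v w| <=
    #|open_nbhd e v| * (2 ^ 4 - 1).
  by apply: leq_card_bigcup => w; rewrite inE; apply: card_branch.
rewrite e_cubic => le45; rewrite (leq_trans (leq_card_setU _ _)) // cards1.
by rewrite -[46]/(1 + 3 * (2 ^ 4 - 1)) leq_add2l.
Qed.

Lemma mem_branch k u v p :
  path e v p -> uniq [:: u, v & p] -> size p <= k -> last v p \in branch k u v.
Proof.
elim: k u v p => [|k IHk] u v [|w p] //=; rewrite ?set11 ?setU11 //.
case/andP=> vw wp /and3P[uvwp vwp uwp] szp; apply/setUP; right.
apply/bigcupP; exists w; last by apply: IHk; rewrite //= vwp.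
by rewrite !inE vw andbT; apply: contraNneq uvwp => ->; rewrite !inE eqxx orbT.
Qed.

(** Shortening the walk to a duplicate-free path rules out backtracking. *)
Lemma path_mem_ball k v p :
  path e v p -> size p <= k -> last v p \in ball k v.
Proof.
move=> vp szp; case/shortenP: vp => p' vp' up' sub.
have {szp}: size p' <= k.
  by apply: leq_trans szp; apply: uniq_leq_size sub; case/andP: up'.
case: p' vp' up' {sub} => [|w p'] /=; first by rewrite setU11.
case/andP=> vw wp' up' szp'; apply/setUP; right; apply/bigcupP.
by exists w; [rewrite inE | apply: mem_branch => //; case: k szp'].
Qed.

(** Steps that stay in place let closed neighborhoods be chained without splitting into cases. *)
Lemma lazy_path_mem_ball k v p :
  path (fun x y => x \in closed_nbhd e y) v p -> size p <= k ->
  last v p \in ball k v.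
Proof.
move=> vp szp; suff [q vq [<- szq]] : exists2 q, path e v q &
    last v q = last v p /\ size q <= size p.
  by apply: path_mem_ball => //; apply: leq_trans szq szp.
elim: p v vp {szp} => [|w p IHp] v /=; first by exists [::].
rewrite closed_nbhdE e_sym => /andP[vw /IHp[q wq [lq szq]]].
case/orP: vw => [/eqP->|vw]; first by exists q; rewrite // lq leqW.
by exists (w :: q); rewrite /= ?vw.
Qed.

(* Membership in [ball] is symmetric for a symmetric [e], but asking for both
   directions here makes it unnecessary to prove this. *)
Definition packing (X : {set V}) : bool :=
  [forall x in X, forall y in X,
    (x \in ball 4 y) && (y \in ball 4 x) ==> (x == y)].

Lemma packingP (X : {set V}) :
  reflect {in X &, forall x y, x \in ball 4 y -> y \in ball 4 x -> x = y}
          (packing X).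
Proof.
apply: (iffP forall_inP) => [pX x y xX yX xy yx | pX x xX].
  by have /forall_inP/(_ y yX) := pX x xX; rewrite xy yx => /eqP.
apply/forall_inP => y yX; apply/implyP => /andP[xy yx].
by apply/eqP; apply: pX.
Qed.

Lemma large_packing : exists2 X, packing X & #|V| <= #|X| * 46.
Proof.
have p0 : packing set0 by apply/packingP => x y; rewrite inE.
have [X /maxsetP[pX maxX] _] := maxset_exists p0.
exists X => //; rewrite -cardsT.
suff -> : [set: V] = \bigcup_(x in X) ball 4 x.
  by apply: leq_card_bigcup => x _; apply: card_ball4.
(* A vertex [v] outside all the balls could be added to [X], against maximality. *)
apply/esym/eqP; rewrite -subTset; apply/subsetP => v _; apply: contraT => vN.
have vball x : x \in X -> v \notin ball 4 x.
  by move=> xX; apply: contra vN => vx; apply/bigcupP; exists x.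
suff /maxX/(_ (subsetUr _ _)) vX : packing (v |: X).
  by have := vball v; rewrite -{1}vX !setU11 => /(_ isT).
apply/packingP => x y /setU1P[-> | xX] /setU1P[-> | yX] //.
- by rewrite (negPf (vball y yX)).
- by rewrite (negPf (vball x xX)).
- exact: (packingP _ pX).
Qed.

(** The walk [x, a, w, b, y] has four lazy steps; it and its reverse put [x] and [y] in each other's
    balls. *)
Lemma packing_meet (X : {set V}) x a w b y :
  packing X -> x \in X -> y \in X ->
  x \in closed_nbhd e a -> a \in closed_nbhd e w ->
  y \in closed_nbhd e b -> b \in closed_nbhd e w -> x = y.
Proof.
have nC u v : (u \in closed_nbhd e v) = (v \in closed_nbhd e u).
  by rewrite !closed_nbhdE eq_sym e_sym.
move=> /packingP pX xX yX xa aw yb bw; apply: pX => //.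
  apply: (@lazy_path_mem_ball 4 y [:: b; w; a; x]) => //.
  by rewrite /= yb bw nC aw nC xa.
apply: (@lazy_path_mem_ball 4 x [:: a; w; b; y]) => //.
by rewrite /= xa aw nC bw nC yb.
Qed.

End Balls.

(** * The complement of a packing is an ERR:LD set *)

Section PackingComplement.
Variables (V : finType) (e : rel V).
Hypotheses (e_sym : symmetric e) (e_irr : irreflexive e).
Hypotheses (e_cubic : cubic e) (e_twin_free : twin_free e).

Let P u v := open_nbhd e u :\: closed_nbhd e v.

(** Of its three elements, N(u) loses the common neighbors and, if adjacent, [v]. This count is
    symmetric in [u] and [v]. *)
Lemma card_nbhdD u v : u != v ->
  #|P u v| = 3 - (#|open_nbhd e u :&: open_nbhd e v| + e u v).
Proof.
move=> nuv; have := cardsID (closed_nbhd e v) (open_nbhd e u).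
rewrite e_cubic -/(P u v) => <-.
rewrite /closed_nbhd setIUr cardsU.
have -> : #|open_nbhd e u :&: [set v]| = e u v.
  case uv: (e u v); first by rewrite (setIidPr _) ?cards1 // sub1set inE.
  by apply/eqP; rewrite cards_eq0 setI_eq0 disjoint_sym disjoints1 inE uv.
have -> : open_nbhd e u :&: [set v] :&: (open_nbhd e u :&: open_nbhd e v)
    = set0.
  apply/setP => w; rewrite !inE; apply/negP => /andP[/andP[_ /eqP->]].
  by rewrite e_irr andbF.
by rewrite cards0; lia.
Qed.

Lemma card_nbhdD_sym u v : u != v -> #|P u v| = #|P v u|.
Proof.
move=> nuv; have nvu : v != u by rewrite eq_sym.
by rewrite !card_nbhdD // setIC e_sym.
Qed.

(** If one difference is empty, so is the other, and then [u] and [v] are closed twins when adjacent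
    and open twins otherwise. *)
Lemma card_nbhdD_gt0 u v : u != v -> 0 < #|P u v|.
Proof.
move=> nuv; rewrite lt0n; apply/negP => c0.
have [Puv Pvu] : open_nbhd e u \subset closed_nbhd e v /\
                 open_nbhd e v \subset closed_nbhd e u.
  by split; rewrite -setD_eq0 -cards_eq0 -/(P _ _) // card_nbhdD_sym // eq_sym.
have /negP := e_twin_free u v; apply; rewrite /twins nuv /=.
case uv: (e u v); apply/orP; [left | right]; rewrite eqEsubset.
  by rewrite !subUset Puv Pvu !sub1set !closed_nbhdE uv e_sym uv !orbT.
apply/andP; split; apply/subsetP => w wN.
  have := subsetP Puv _ wN; rewrite closed_nbhdE inE => /orP[/eqP wv|//].
  by move: wN; rewrite wv inE uv.
have := subsetP Pvu _ wN; rewrite closed_nbhdE inE => /orP[/eqP wv|//].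
by move: wN; rewrite wv inE e_sym uv.
Qed.

Lemma closed_nbhd_meet u v : u != v -> #|P u v| <= 1 ->
  exists w, (u \in closed_nbhd e w) && (v \in closed_nbhd e w).
Proof.
move=> nuv; rewrite card_nbhdD //; case uv: (e u v) => c.
  by exists u; rewrite !closed_nbhdE eqxx uv orbT.
have /card_gt0P[w] : 0 < #|open_nbhd e u :&: open_nbhd e v| by lia.
rewrite !inE => /andP[uw vw]; exists w.
by rewrite !closed_nbhdE ![e w _]e_sym uw vw !orbT.
Qed.

Lemma packing_closed_nbhd (X : {set V}) v :
  packing e X -> #|closed_nbhd e v :&: X| <= 1.
Proof.
move=> pX; apply/card_le1_eqP => y x /setIP[yv yX] /setIP[xv xX].
by apply: (packing_meet (w := v) e_sym pX xX yX xv _ yv); rewrite setU11.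
Qed.

(** This is the separation condition for [~: X]: of the 2 + 2d vertices in these sets, where d is
    [#|P u v|], at least 3 must avoid [X]. *)
Lemma card_symdiff_meet (X : {set V}) u v : u != v -> packing e X ->
  #|[set u; v] :&: X| + #|P u v :&: X| + #|P v u :&: X| < #|P u v| + #|P v u|.
Proof.
move=> nuv pX; rewrite -(card_nbhdD_sym nuv).
have cardU x y : #|closed_nbhd e x :&: X| <= 1 ->
    #|[set x] :&: X| + #|P x y :&: X| <= 1.
  move=> /(leq_trans _); apply.
  rewrite -cardsUI -setIUl (_ : _ :&: (_ :&: _) = set0) ?cards0 ?addn0.
    by apply/subset_leq_card/setSI/setUS/subsetDl.
  apply/setP => w; rewrite !inE; apply/negP.
  by case/andP=> /andP[/eqP-> _]; rewrite e_irr andbF.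
have le_uv : #|[set u; v] :&: X| <= #|[set u] :&: X| + #|[set v] :&: X|.
  by rewrite setIUl leq_card_setU.
(* If d >= 2, then N[u] and N[v] contribute at most one element of [X] each, and 2 < 2d. *)
have [d2|d1] := ltnP 1 #|P u v|.
  have := cardU u v (packing_closed_nbhd u pX).
  have := cardU v u (packing_closed_nbhd v pX); lia.
have [w /andP[uw vw]] := closed_nbhd_meet nuv d1.
have d0 := card_nbhdD_gt0 nuv.
(* Now d = 1. The three sets are disjoint, so bounding their union bounds the sum. *)
suff: #|([set u; v] :|: (P u v :|: P v u)) :&: X| <= 1.
  rewrite !setIUl -setIUl cardsU (_ : _ :&: (_ :|: _) = set0); last first.
    apply/setP => x; rewrite !inE; apply/negP.
    case/andP=> /andP[/orP[]/eqP-> _]; rewrite !eqxx !e_irr ?andbF //=;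
      by rewrite ?orbT ?andbF.
  rewrite cards0 subn0 cardsU (_ : _ :&: _ :&: _ = set0); last first.
    apply/setP => x; rewrite !inE; apply/negP.
    by case: (e u x); rewrite ?orbT ?andbF.
  rewrite cards0 subn0; lia.
have near x : x \in [set u; v] :|: (P u v :|: P v u) ->
    exists2 a, x \in closed_nbhd e a & a \in closed_nbhd e w.
  rewrite !in_setU !in_setD !in_set1 !inE.
  case/orP=> [/orP[]/eqP->|/orP[]/andP[_ ux]].
  - by exists u; rewrite ?setU11.
  - by exists v; rewrite ?setU11.
  - by exists u; rewrite ?closed_nbhdE ?ux ?orbT // -closed_nbhdE.
  - by exists v; rewrite ?closed_nbhdE ?ux ?orbT // -closed_nbhdE.
apply/card_le1_eqP => y x /setIP[/near[b yb bw] yX] /setIP[/near[a xa aw] xX].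
exact: (packing_meet e_sym pX xX yX xa aw yb bw).
Qed.

Lemma packing_errld (X : {set V}) : packing e X -> errld_set e (~: X).
Proof.
move=> pX; apply/errld_setP => //; split=> [v|u v nuv].
  (* N[v] has four vertices, at most one of them in [X]. *)
  have := cardsID X (closed_nbhd e v); rewrite setDE.
  have := packing_closed_nbhd v pX.
  by rewrite cardsU1 e_cubic inE e_irr; lia.
have -> : (open_nbhd e v :&: ~: X :\: open_nbhd e u :&: ~: X
      :|: open_nbhd e u :&: ~: X :\: open_nbhd e v :&: ~: X) :\: [set v; u]
    = (P u v :\: X) :|: (P v u :\: X).
  apply/setP => w; rewrite !inE.
  have [->|] := eqVneq w u; first by rewrite !e_irr !(andbF, orbF, orbT).
  have [->|] := eqVneq w v; first by rewrite !e_irr !(andbF, orbF, orbT).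
  by case: (w \in X); case: (e u w); case: (e v w).
rewrite cardsU (_ : (P u v :\: X) :&: _ = set0); last first.
  apply/setP => w; rewrite !inE.
  by case: (e u w); rewrite ?(orbT, andbF).
rewrite cards0 subn0.
have := card_symdiff_meet nuv pX.
have := cardsID X (P u v); have := cardsID X (P v u).
have := cardsID X [set u; v]; rewrite cards2 nuv [[set v; u]]setUC setDE /=.
lia.
Qed.

(** The set [~: X] has n - |X| elements, and n <= 46 |X|. *)
Lemma ERRLD_bound : 46 * ERRLD e <= 45 * #|V|.
Proof.
have [X pX leX] := large_packing e_sym e_cubic.
have eX := packing_errld pX.
have [_ /(_ _ eX)] := ERRLD_spec eX.
have := cardsC X; lia.
Qed.

End PackingComplement.

Theorem proposition4p1 (V : finType) (e : rel V)
    (e_sym : symmetric e) (e_irr : irreflexive e)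
    (e_cubic : cubic e) (e_twin_free : twin_free e)
    (n_ge46 : 46 <= #|V|) :
  ((ERRLD e)%:Z <= Num.ceil (45%:Q / 46%:Q * #|V|%:Q))%R.
Proof.
have bound := ERRLD_bound e_sym e_irr e_cubic e_twin_free.
suff le_rat : ((ERRLD e)%:R <= 45 / 46 * #|V|%:R :> rat)%R.
  rewrite -(ler_int rat).
  exact: Order.POrderTheory.le_trans le_rat (Num.Theory.ceil_ge _).
have : ((46 * ERRLD e)%N%:R <= (45 * #|V|)%N%:R :> rat)%R.
  by rewrite Num.Theory.ler_nat.
rewrite !GRing.natrM; lra.
Qed.
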